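(* (1) There exist a deterministic game structure $G$ and states $s,t$ of $G$ such that $s\sqsubseteq^{\Gamma}_1 t$ but not $s\preceq_1 t$, and $s\cong^{\Gamma}_1 t$ but not $s\simeq_g t$. (2) There exist a turn-based game structure $G$ and states $s,t$ of $G$ such that $s\preceq_1 t$ but not $s\sqsubseteq^{\Gamma}_1 t$, and $s\simeq_g t$ but not $s\cong^{\Gamma}_1 t$.
   Context: A game structure $G=(S,[\cdot],\mathit{Moves},\Gamma_1,\Gamma_2,\delta)$: finite state set $S$; finite set $V$ of observation variables, each $v$ interpreted as $[v]:S\to[0,1]$; finite move set; $\Gamma_1,\Gamma_2:S\to2^{\mathit{Moves}}\setminus\{\emptyset\}$; $\delta:S\times\mathit{Moves}\times\mathit{Moves}\to\mathrm{Distr}(S)$. Deterministic: every $\delta(s,a_1,a_2)$ is a point mass. Turn-based: $S=S_1\uplus S_2$ with $|\Gamma_2(s)|=1$ on $S_1$, $|\Gamma_1(s)|=1$ on $S_2$, and some $\mathit{turn}\in V$ has $[\mathit{turn}](s)=1$ iff $s\in S_1$, $=0$ iff $s\in S_2$. $s\equiv t$ means $[v](s)=[v](t)$ for all $v$; $[s\equiv t]=\max_v|[v](s)-[v](t)|$. $\bar i=3-i$. Mixed moves $\mathcal{D}_i(s)=\mathrm{Distr}(\Gamma_i(s))$; $\delta(s,x_1,x_2)(u)=\sum_{a_1,a_2}\delta(s,a_1,a_2)(u)x_1(a_1)x_2(a_2)$. Valuations $k:S\to[0,1]$; $\mathrm{E}^{x_1,x_2}_s(k)=\sum_u\delta(s,x_1,x_2)(u)k(u)$;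 $\mathrm{Pre}_i(k)(s)=\sup_{x_i\in\mathcal{D}_i(s)}\inf_{x_{\bar i}\in\mathcal{D}_{\bar i}(s)}\mathrm{E}^{x_1,x_2}_s(k)$. A priori metrics: directed metrics $d:S\times S\to\mathbb{R}_{\ge0}$ ($d(s,s)=0$, triangle inequality), ordered pointwise; $\breve d(s,t)=d(t,s)$; $\sqcup=\max$; $C(d)=\{k:k(s)-k(t)\le d(s,t)\}$; $H_{\preceq_i}(d)(s,t)=[s\equiv t]\sqcup\sup_{k\in C(d)}(\mathrm{Pre}_i(k)(s)-\mathrm{Pre}_i(k)(t))$; $[\preceq_1]$ is the least fixpoint of $H_{\preceq_1}$; $[\simeq_i]$ the least fixpoint of $d\mapsto H_{\preceq_i}(d)\sqcup\breve{H_{\preceq_i}(d)}$; $[\simeq_1]=[\simeq_2]=:[\simeq_g]$. $s\preceq_1 t$ iff $[\preceq_1](s,t)=0$; $s\simeq_g t$ iff $[\simeq_g](s,t)=0$. Alternating relations with pure moves: for $R\subseteq S\times S$ and $p,q\in\mathrm{Distr}(S)$, $p\sqsubseteq_R q$ iff there is $\Delta:S\times S\to[0,1]$ with $\Delta(u,u')>0\Rightarrow(u,u')\in R$, $p(u)=\sum_{u'}\Delta(u,u')$ and $q(u')=\sum_u\Delta(u,u')$. $\sqsubseteq^{\Gamma}_1$ is the largest relation $R$ such that $sRt$ implies $s\equiv t$ and $\forall a_1\in\Gamma_1(s).\exists b_1\in\Gamma_1(t).\forall b_2\in\Gamma_2(t).\exists a_2\in\Gamma_2(s).\ \delta(s,a_1,a_2)\sqsubseteq_R\delta(t,b_1,b_2)$;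 $\cong^{\Gamma}_1$ is the largest symmetrical relation with the same two properties. *)

(* Defs.v *)
From HB Require Import structures.
From mathcomp Require Import all_boot all_order all_algebra.
From mathcomp Require Import boolp classical_sets reals.

Set Implicit Arguments.
Unset Strict Implicit.
Unset Printing Implicit Defensive.

Import Order.TTheory GRing.Theory Num.Theory.
Local Open Scope ring_scope.

Record distr (R : realType) (A : finType) := Distr {
  dval :> A -> R;
  dval_ge0 : forall a, 0 <= dval a;
  dval_sum1 : \sum_a dval a = 1 }.

Variant player := P1 | P2.

Definition opponent (i : player) : player :=
  match i with P1 => P2 | P2 => P1 end.

Record game (R : realType) := Game {
  state : finType;
  obsvar : finType;
  move : finType;
  obs : obsvar -> state -> R;
  obs_itv : forall v s, 0 <= obs v s <= 1;
  avail : player -> state -> {set move};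
  avail_neq0 : forall i s, exists a, a \in avail i s;
  delta : state -> move -> move -> distr R state }.

Section Games.
Context {R : realType}.
Variable G : game R.
Local Notation S := (state G).

Definition deterministic : Prop :=
  forall (s : S) (a1 a2 : move G),
    exists u, forall u', delta s a1 a2 u' = (u' == u)%:R.

(* The player-2 states are the complement of [S1]. *)
Definition turn_based : Prop :=
  exists S1 : {set S},
    [/\ forall s, s \in S1 -> #|avail P2 s| = 1%N,
        forall s, s \notin S1 -> #|avail P1 s| = 1%N &
        exists turn : obsvar G, forall s : S,
          (obs turn s = 1 <-> s \in S1) /\ (obs turn s = 0 <-> s \notin S1)].

Definition obs_equiv (s t : S) : Prop := forall v : obsvar G, obs v s = obs v t.

(* 0 is a neutral default, the terms being nonnegative. *)
Definition obs_dist (s t : S) : R :=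
  \big[Num.max/0]_(v : obsvar G) `|obs v s - obs v t|.

(* Distr(Gamma_i(s)), as the distributions on all moves that vanish outside
   Gamma_i(s). *)
Definition mixed (i : player) (s : S) : set (distr R (move G)) :=
  [set x : distr R (move G) | forall a, a \notin avail i s -> x a = 0]%classic.

Definition mdelta (s : S) (x1 x2 : distr R (move G)) (u : S) : R :=
  \sum_(a1 in avail P1 s) \sum_(a2 in avail P2 s)
    delta s a1 a2 u * x1 a1 * x2 a2.

Definition expect (s : S) (x1 x2 : distr R (move G)) (k : S -> R) : R :=
  \sum_u mdelta s x1 x2 u * k u.

(* [x] is the mixed move of player [i] and [y] that of the opponent. *)
Definition expect_for (i : player) (s : S) (x y : distr R (move G))
    (k : S -> R) : R :=
  match i with P1 => expect s x y k | P2 => expect s y x k end.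

Definition Pre (i : player) (k : S -> R) (s : S) : R :=
  sup [set inf [set expect_for i s x y k | y in mixed (opponent i) s]
      | x in mixed i s]%classic.

Definition valuation (k : S -> R) : Prop := forall s, 0 <= k s <= 1.

Definition dirmetric (d : S -> S -> R) : Prop :=
  [/\ forall s t, 0 <= d s t,
      forall s, d s s = 0 &
      forall s t u, d s u <= d s t + d t u].

Definition Cset (d : S -> S -> R) : set (S -> R) :=
  [set k : S -> R | valuation k /\ forall s t, k s - k t <= d s t]%classic.

Definition Hsim (i : player) (d : S -> S -> R) (s t : S) : R :=
  Num.max (obs_dist s t) (sup [set Pre i k s - Pre i k t | k in Cset d]%classic).

Definition Hbisim (i : player) (d : S -> S -> R) (s t : S) : R :=
  Num.max (Hsim i d s t) (Hsim i d t s).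

Definition is_lfp (H : (S -> S -> R) -> S -> S -> R) (d : S -> S -> R) : Prop :=
  [/\ dirmetric d, H d = d &
      forall d', dirmetric d' -> H d' = d' -> forall s t, d s t <= d' s t].

(* [Hsim i] and [Hbisim i] are monotone on the complete lattice of directed
   metrics bounded by 1, so the default value is never used below. *)
Definition lfp (H : (S -> S -> R) -> S -> S -> R) : S -> S -> R :=
  xget (fun _ _ => 0) [set d | is_lfp H d]%classic.

Definition sim_metric (i : player) : S -> S -> R := lfp (Hsim i).
Definition bisim_metric (i : player) : S -> S -> R := lfp (Hbisim i).

Definition simulated (i : player) (s t : S) : Prop := sim_metric i s t = 0.

(* The metrics [bisim_metric P1] and [bisim_metric P2] coincide; the game
   bisimulation metric is their common value. *)
Definition game_bisimilar (s t : S) : Prop := bisim_metric P1 s t = 0.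

Definition lift_rel (r : {set S * S}) (p q : distr R S) : Prop :=
  exists D : S -> S -> R,
    [/\ forall u u', 0 <= D u u' <= 1,
        forall u u', 0 < D u u' -> (u, u') \in r,
        forall u, p u = \sum_u' D u u' &
        forall u', q u' = \sum_u D u u'].

Definition alt_sim (r : {set S * S}) : Prop :=
  forall s t, (s, t) \in r ->
    obs_equiv s t /\
    forall a1, a1 \in avail P1 s -> exists2 b1, b1 \in avail P1 t &
    forall b2, b2 \in avail P2 t -> exists2 a2, a2 \in avail P2 s &
      lift_rel r (delta s a1 a2) (delta t b1 b2).

Definition alt_bisim (r : {set S * S}) : Prop :=
  (forall s t, (s, t) \in r -> (t, s) \in r) /\ alt_sim r.

Definition is_largest (P : {set S * S} -> Prop) (r : {set S * S}) : Prop :=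
  P r /\ forall r', P r' -> r' \subset r.

(* [alt_sim] and [alt_bisim] are closed under unions, so the default value is
   never used below. *)
Definition largest (P : {set S * S} -> Prop) : {set S * S} :=
  xget finset.set0 [set r | is_largest P r]%classic.

Definition alt_simulated (s t : S) : Prop := (s, t) \in largest alt_sim.
Definition alt_bisimilar (s t : S) : Prop := (s, t) \in largest alt_bisim.

End Games.

(* Main.v *)
Require Import Defs.
From mathcomp Require Import all_boot all_order all_algebra.
From mathcomp Require Import boolp classical_sets reals.
From mathcomp Require Import ring lra.

(** (1) Let [s] be matching pennies and [t] the same game in which player 1 has
    only one side of the coin.  With pure moves player 2, answering second, can
    reproduce any outcome in either state, so [s] and [t] are alternating
    bisimilar; but in [s] player 1 wins with probability 1/2 by randomizing,
    and never in [t].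
    (2) Let player 1 choose between two distinguishable sinks in [t], and let
    [s] offer in addition the fair lottery over them.  Every valuation has the
    same value in [s] and [t], since a lottery is never better than the best
    sink; but no pure move of [t] matches the lottery. *)

Set Implicit Arguments.
Unset Strict Implicit.
Unset Printing Implicit Defensive.

Import Order.TTheory GRing.Theory Num.Theory.
Local Open Scope ring_scope.

(** * Point masses and elementary facts on distributions *)

Section Distributions.
Context {R : realType}.

Lemma point_ge0 (A : finType) (a b : A) : 0 <= (b == a)%:R :> R.
Proof. by rewrite ler0n. Qed.

Lemma point_sum1 (A : finType) (a : A) : \sum_b (b == a)%:R = 1 :> R.
Proof. by rewrite (bigD1 a) //= eqxx big1 ?addr0 // => b /negbTE ->. Qed.

Definition point (A : finType) (a : A) : distr R A :=
  Distr (point_ge0 a) (point_sum1 a).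

Lemma sum_pointM (A : finType) (P : pred A) (a : A) (F : A -> R) :
  P a -> \sum_(b | P b) point a b * F b = F a.
Proof.
move=> Pa; rewrite (bigD1 a) //= eqxx mul1r big1 ?addr0 // => b.
by case/andP => _ /negbTE ->; rewrite mul0r.
Qed.

Lemma distr_le1 (A : finType) (p : distr R A) a : p a <= 1.
Proof.
rewrite -(dval_sum1 p) (bigD1 a) //= lerDl.
by apply: sumr_ge0 => b _; apply: dval_ge0.
Qed.

End Distributions.

(** * Expectations under mixed moves and bounds on [Pre] *)

Section Metrics.
Context {R : realType} {G : game R}.
Local Notation S := (state G).
Implicit Types (s t : S) (k : S -> R) (i : player) (d : S -> S -> R).
Implicit Types (x y : distr R (move G)).

Definition pure_expect s (a1 a2 : move G) k : R := \sum_u delta s a1 a2 u * k u.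

(** Nested averages, to which the bounds on averages over mixed moves apply one player at a time. *)
Lemma expectE s x1 x2 k : expect s x1 x2 k =
  \sum_(a1 in avail P1 s) x1 a1 *
    \sum_(a2 in avail P2 s) x2 a2 * pure_expect s a1 a2 k.
Proof.
rewrite /expect /mdelta /pure_expect.
under eq_bigr do rewrite mulr_suml.
rewrite exchange_big /=; apply: eq_bigr => a1 _.
under eq_bigr do rewrite mulr_suml.
rewrite exchange_big /= mulr_sumr; apply: eq_bigr => a2 _.
rewrite !mulr_sumr; apply: eq_bigr => u _.
by ring.
Qed.

Lemma mixed_sum1 i s x : mixed i s x -> \sum_(a in avail i s) x a = 1.
Proof.
move=> mx; rewrite -(dval_sum1 x) [RHS](bigID (mem (avail i s))) /=.
by rewrite [X in _ + X]big1 ?addr0 // => a /mx.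
Qed.

Lemma mixed_average_le i s x (F : move G -> R) c : mixed i s x ->
  (forall a, a \in avail i s -> F a <= c) ->
  \sum_(a in avail i s) x a * F a <= c.
Proof.
move=> mx le_c; rewrite -[leRHS]mul1r -(mixed_sum1 mx) mulr_suml.
by apply: ler_sum => a /le_c Fc; apply: ler_wpM2l => //; apply: dval_ge0.
Qed.

Lemma mixed_average_ge i s x (F : move G -> R) c : mixed i s x ->
  (forall a, a \in avail i s -> c <= F a) ->
  c <= \sum_(a in avail i s) x a * F a.
Proof.
move=> mx ge_c; rewrite -[leLHS]mul1r -(mixed_sum1 mx) mulr_suml.
by apply: ler_sum => a /ge_c Fc; apply: ler_wpM2l => //; apply: dval_ge0.
Qed.

Lemma mixed_point i s a : a \in avail i s -> mixed i s (point a).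
Proof. by move=> sa b /=; case: eqP => // ->; rewrite sa. Qed.

Lemma mixed_nonempty i s : exists x, mixed i s x.
Proof. by have [a sa] := avail_neq0 i s; exists (point a); exact: mixed_point. Qed.

Lemma pure_expect_itv s a1 a2 k : valuation k -> 0 <= pure_expect s a1 a2 k <= 1.
Proof.
move=> vk; apply/andP; split.
  apply: sumr_ge0 => u _; apply: mulr_ge0; first exact: dval_ge0.
  by case/andP: (vk u).
rewrite -(dval_sum1 (delta s a1 a2)); apply: ler_sum => u _.
by apply: ler_piMr; [exact: dval_ge0 | case/andP: (vk u)].
Qed.

Lemma expect_itv s x1 x2 k : valuation k -> mixed P1 s x1 -> mixed P2 s x2 ->
  0 <= expect s x1 x2 k <= 1.
Proof.
move=> vk m1 m2; rewrite expectE; apply/andP; split.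
  apply: (mixed_average_ge m1) => a1 _; apply: (mixed_average_ge m2) => a2 _.
  by case/andP: (pure_expect_itv s a1 a2 vk).
apply: (mixed_average_le m1) => a1 _; apply: (mixed_average_le m2) => a2 _.
by case/andP: (pure_expect_itv s a1 a2 vk).
Qed.

Lemma expect_for_itv i s x y k :
  valuation k -> mixed i s x -> mixed (opponent i) s y ->
  0 <= expect_for i s x y k <= 1.
Proof. by case: i => vk mx my; apply: expect_itv. Qed.

(** A valuation keeps all expectations nonnegative, so the infimum is over a set bounded below. *)
Lemma inf_expect_le i s x y k :
  valuation k -> mixed i s x -> mixed (opponent i) s y ->
  inf [set expect_for i s x y k | y in mixed (opponent i) s]%classic
    <= expect_for i s x y k.
Proof.
move=> vk mx my; apply: ge_inf; last by exists y.
by exists 0 => _ [z mz <-]; case/andP: (expect_for_itv vk mx mz).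
Qed.

(** Real [sup] and [inf] are meaningful only on nonempty bounded sets; these obligations are met
    here and in [Pre_le], which then serve as the rules for bounding [Pre]. *)
Lemma Pre_ge i s x k c : valuation k -> mixed i s x ->
  (forall y, mixed (opponent i) s y -> c <= expect_for i s x y k) ->
  c <= Pre i k s.
Proof.
move=> vk mx ge_c.
apply: (@le_trans _ _
  (inf [set expect_for i s x y k | y in mixed (opponent i) s]%classic)).
  apply: lb_le_inf; last by move=> _ [y my <-]; exact: ge_c.
  by have [y my] := mixed_nonempty (opponent i) s; exists (expect_for i s x y k), y.
apply: ub_le_sup; last by exists x.
exists 1 => _ [z mz <-].
have [y my] := mixed_nonempty (opponent i) s.
apply: le_trans (inf_expect_le vk mz my) _.
by case/andP: (expect_for_itv vk mz my).
Qed.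

Lemma Pre_le i s k c : valuation k ->
  (forall x, mixed i s x ->
     exists2 y, mixed (opponent i) s y & expect_for i s x y k <= c) ->
  Pre i k s <= c.
Proof.
move=> vk le_c; apply: ge_sup.
  have [x mx] := mixed_nonempty i s.
  by exists (inf [set expect_for i s x y k | y in mixed (opponent i) s]%classic), x.
move=> _ [x mx <-]; have [y my xy] := le_c x mx.
exact: le_trans (inf_expect_le vk mx my) xy.
Qed.

Lemma Pre_itv i s k : valuation k -> 0 <= Pre i k s <= 1.
Proof.
move=> vk; apply/andP; split.
  have [x mx] := mixed_nonempty i s; apply: (Pre_ge vk mx) => y my.
  by case/andP: (expect_for_itv vk mx my).
apply: (Pre_le vk) => x mx; have [y my] := mixed_nonempty (opponent i) s.
by exists y => //; case/andP: (expect_for_itv vk mx my).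
Qed.

(** For fixed [x] the expectation is an average over the moves of player 2, so a bound against pure
    replies suffices. *)
Lemma Pre1_ge_mixed s x k c : valuation k -> mixed P1 s x ->
  (forall a2, a2 \in avail P2 s ->
     c <= \sum_(a1 in avail P1 s) x a1 * pure_expect s a1 a2 k) ->
  c <= Pre P1 k s.
Proof.
move=> vk mx ge_c; apply: (Pre_ge vk mx) => y my.
rewrite /= expectE.
have -> : \sum_(a1 in avail P1 s) x a1 *
    (\sum_(a2 in avail P2 s) y a2 * pure_expect s a1 a2 k) =
  \sum_(a2 in avail P2 s) y a2 *
    \sum_(a1 in avail P1 s) x a1 * pure_expect s a1 a2 k.
  under eq_bigr do rewrite mulr_sumr.
  rewrite exchange_big /=; apply: eq_bigr => a2 _.
  by rewrite mulr_sumr; apply: eq_bigr => a1 _; rewrite mulrCA.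
exact: mixed_average_ge.
Qed.

Lemma Pre1_ge_pure s a1 k c : valuation k -> a1 \in avail P1 s ->
  (forall a2, a2 \in avail P2 s -> c <= pure_expect s a1 a2 k) ->
  c <= Pre P1 k s.
Proof.
move=> vk sa ge_c; apply: (Pre1_ge_mixed vk (mixed_point sa)) => a2 /ge_c.
by rewrite sum_pointM.
Qed.

(** The same pure reply [a2] answers every mixed move of player 1, leaving an average of values at
    most [c]. *)
Lemma Pre1_le_pure s a2 k c : valuation k -> a2 \in avail P2 s ->
  (forall a1, a1 \in avail P1 s -> pure_expect s a1 a2 k <= c) ->
  Pre P1 k s <= c.
Proof.
move=> vk sa le_c; apply: (Pre_le vk) => x mx.
exists (point a2); first exact: mixed_point.
rewrite /= expectE; apply: (mixed_average_le mx) => a1 /le_c.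
by rewrite sum_pointM.
Qed.

(** * The observation distance *)

Lemma obs_dist_le s t c :
  0 <= c -> (forall v, `|obs v s - obs v t| <= c) -> obs_dist s t <= c.
Proof.
move=> c0 le_c; rewrite /obs_dist; elim/big_ind: _ => // a b ac bc.
by rewrite ge_max ac.
Qed.

Lemma obs_dist_ge v s t : `|obs v s - obs v t| <= obs_dist s t.
Proof. by rewrite /obs_dist (bigD1 v) //= le_max lexx. Qed.

Lemma obs_dist_ge0 s t : 0 <= obs_dist s t.
Proof.
by rewrite /obs_dist; elim/big_ind: _ => // a b a0 b0; rewrite le_max a0.
Qed.

Lemma obs_dist_le1 s t : obs_dist s t <= 1.
Proof.
apply: obs_dist_le => // v; rewrite ler_norml.
have /andP[? ?] := obs_itv v s; have /andP[? ?] := obs_itv v t.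
by apply/andP; split; lra.
Qed.

Lemma obs_dist_eq0 s t : obs_equiv s t -> obs_dist s t = 0.
Proof.
move=> st; apply/eqP; rewrite eq_le obs_dist_ge0 andbT.
by apply: obs_dist_le => // v; rewrite st subrr normr0.
Qed.

Lemma obs_dist_triangle s t u : obs_dist s u <= obs_dist s t + obs_dist t u.
Proof.
apply: obs_dist_le => [|v]; first by rewrite addr_ge0 ?obs_dist_ge0.
by apply: le_trans (ler_distD (obs v t) _ _) _; apply: lerD; exact: obs_dist_ge.
Qed.

(** * The operators [Hsim] and [Hbisim] on directed metrics *)

Lemma Hsim_ge_Pre i d s t k : Cset d k -> Pre i k s - Pre i k t <= Hsim i d s t.
Proof.
move=> Ck; rewrite le_max; apply/orP; right; apply: ub_le_sup; last by exists k.
exists 1 => _ [l [vl _] <-].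
have /andP[? ?] := Pre_itv i s vl; have /andP[? ?] := Pre_itv i t vl; lra.
Qed.

Lemma Hsim_le i d s t c : dirmetric d -> obs_dist s t <= c ->
  (forall k, Cset d k -> Pre i k s - Pre i k t <= c) -> Hsim i d s t <= c.
Proof.
move=> [d0 _ _] obs_c Pre_c; rewrite ge_max obs_c /=; apply: ge_sup.
  (* The constant 0 lies in [Cset d] because [d] is nonnegative, so the supremum is over a nonempty
     set. *)
  by exists (Pre i (fun=> 0) s - Pre i (fun=> 0) t), (fun=> 0) => //;
     split=> [u|u v]; rewrite ?lexx ?ler01 ?subrr.
by move=> _ [k Ck <-]; exact: Pre_c.
Qed.

Lemma Hsim_ge0 i d s t : 0 <= Hsim i d s t.
Proof. by rewrite le_max obs_dist_ge0. Qed.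

Lemma Hsim_le1 i d s t : dirmetric d -> Hsim i d s t <= 1.
Proof.
move=> dd; apply: Hsim_le => // [|k [vk _]]; first exact: obs_dist_le1.
have /andP[? ?] := Pre_itv i s vk; have /andP[? ?] := Pre_itv i t vk; lra.
Qed.

Lemma Hsim_eq0 i d s t : dirmetric d -> obs_equiv s t ->
  (forall k, valuation k -> Pre i k s = Pre i k t) -> Hsim i d s t = 0.
Proof.
move=> dd st Pst; apply/eqP; rewrite eq_le Hsim_ge0 andbT.
by apply: Hsim_le => // [|k [vk _]]; rewrite ?obs_dist_eq0 // Pst ?subrr.
Qed.

(** For each [k] the differences of [Pre i k] telescope through the middle state. *)
Lemma Hsim_dirmetric i d : dirmetric d -> dirmetric (Hsim i d).
Proof.
move=> dd; split=> [s t|s|s t u]; first exact: Hsim_ge0.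
  exact: Hsim_eq0.
apply: Hsim_le => // [|k Ck].
  apply: le_trans (obs_dist_triangle s t u) _.
  by apply: lerD; rewrite le_max lexx.
by have := Hsim_ge_Pre i s t Ck; have := Hsim_ge_Pre i t u Ck; lra.
Qed.

(** A larger metric admits more test functions. *)
Lemma Hsim_mono i d e : dirmetric d -> (forall s t, d s t <= e s t) ->
  forall s t, Hsim i d s t <= Hsim i e s t.
Proof.
move=> dd de s t; apply: Hsim_le => // [|k [vk kd]]; first by rewrite le_max lexx.
by apply: Hsim_ge_Pre; split=> // u v; exact: le_trans (kd u v) (de u v).
Qed.

Lemma Hbisim_le1 i d s t : dirmetric d -> Hbisim i d s t <= 1.
Proof. by move=> dd; rewrite ge_max !Hsim_le1. Qed.

Lemma Hbisim_dirmetric i d : dirmetric d -> dirmetric (Hbisim i d).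
Proof.
move=> dd; have [H0 Hs Ht] := Hsim_dirmetric i dd.
split=> [s t|s|s t u]; first by rewrite le_max H0.
  by rewrite /Hbisim Hs maxxx.
rewrite ge_max; apply/andP; split.
  by apply: le_trans (Ht s t u) _; apply: lerD; rewrite le_max lexx.
(* The converse direction runs from [u] through [t] to [s], hence the swap of the summands. *)
apply: le_trans (Ht u t s) _; rewrite addrC.
by apply: lerD; rewrite le_max lexx orbT.
Qed.

Lemma Hbisim_mono i d e : dirmetric d -> (forall s t, d s t <= e s t) ->
  forall s t, Hbisim i d s t <= Hbisim i e s t.
Proof.
move=> dd de s t; rewrite ge_max; apply/andP; split; rewrite le_max.
  by rewrite (Hsim_mono i dd de).
by rewrite [X in _ || X](Hsim_mono i dd de) orbT.
Qed.

(** * Existence of least fixpoints among directed metrics *)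

Lemma discrete_dirmetric : dirmetric (fun s t => (s != t)%:R : R).
Proof.
split=> [s t|s|s t u]; rewrite ?ler0n ?eqxx //.
have [->|_] /= := eqVneq s t; first by rewrite add0r.
by apply: (@le_trans _ _ 1); rewrite ?lerDl ?ler0n // lern1 leq_b1.
Qed.

(* Directed metrics are closed under suprema but not under infima, so the meet
   of the prefixpoints is taken as the supremum of their lower bounds. *)
Lemma is_lfp_exists (H : (S -> S -> R) -> S -> S -> R) :
  (forall d, dirmetric d -> dirmetric (H d)) ->
  (forall d s t, dirmetric d -> H d s t <= 1) ->
  (forall d e, dirmetric d -> (forall s t, d s t <= e s t) ->
     forall s t, H d s t <= H e s t) ->
  exists d, is_lfp H d.
Proof.
move=> Hdir H1 Hmono.
pose pre e := dirmetric e /\ forall s t, H e s t <= e s t.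
pose low d := dirmetric d /\ forall e, pre e -> forall s t, d s t <= e s t.
have pre_disc : pre (fun s t => (s != t)%:R).
  split=> [|s t]; first exact: discrete_dirmetric.
  have [->|_] := eqVneq s t; last exact: H1 discrete_dirmetric.
  by have [_ -> _] := Hdir _ discrete_dirmetric.
have low0 : low (fun _ _ => 0).
  split=> [|e [[e0 _ _] _] s t //].
  by split=> // *; rewrite addr0.
pose m s t := sup [set d s t | d in low]%classic.
(* The discrete metric is a prefixpoint because [H] is bounded by 1; it thus bounds all of [low] and
   makes the supremum [m] proper. *)
have ge_m d s t : low d -> d s t <= m s t.
  move=> ld; apply: ub_le_sup; last by exists d.
  by exists (s != t)%:R => _ [d' [_ /(_ _ pre_disc s t)] + <-].
have le_m s t c : (forall d, low d -> d s t <= c) -> m s t <= c.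
  move=> le_c; apply: ge_sup; first by exists 0, (fun _ _ => 0).
  by move=> _ [d ld <-]; exact: le_c.
have m_dir : dirmetric m.
  split=> [s t|s|s t u]; first exact: (ge_m _ s t low0).
    apply/eqP; rewrite eq_le (ge_m _ s s low0) andbT.
    by apply: le_m => d [[_ -> _] _].
  apply: le_m => d ld; have [[_ _ dt] _] := ld.
  by apply: le_trans (dt s t u) _; apply: lerD; exact: ge_m.
have m_low e : pre e -> forall s t, m s t <= e s t.
  by move=> pe s t; apply: le_m => d [_]; exact.
(* As in Knaster-Tarski: [H m] is again a lower bound of the prefixpoints, hence below [m]; it is
   then a prefixpoint itself, hence above [m]. *)
have Hm_le s t : H m s t <= m s t.
  apply: (ge_m (H m)); split=> [|e pe u v]; first exact: Hdir.
  by apply: le_trans (Hmono _ _ m_dir (m_low e pe) u v) _; case: pe.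
have Hm_ge s t : m s t <= H m s t.
  apply: m_low; split; first exact: Hdir.
  exact: Hmono (Hdir _ m_dir) Hm_le.
exists m; split=> // [|e ed He s t].
  by apply/funext => s; apply/funext => t; apply/eqP; rewrite eq_le Hm_le Hm_ge.
by apply: m_low; split=> // u v; rewrite He.
Qed.

(** * The metrics as fixpoints, and criteria for distance zero *)

Lemma sim_metricP i : is_lfp (Hsim i) (@sim_metric R G i).
Proof.
apply: xgetPex; apply: is_lfp_exists.
- exact: Hsim_dirmetric.
- by move=> d s t; exact: Hsim_le1.
- exact: Hsim_mono.
Qed.

Lemma bisim_metricP i : is_lfp (Hbisim i) (@bisim_metric R G i).
Proof.
apply: xgetPex; apply: is_lfp_exists.
- exact: Hbisim_dirmetric.
- by move=> d s t; exact: Hbisim_le1.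
- exact: Hbisim_mono.
Qed.

Lemma same_Pre_simulated i s t : obs_equiv s t ->
  (forall k, valuation k -> Pre i k s = Pre i k t) -> simulated i s t.
Proof.
move=> st Pst; have [dd Hd _] := sim_metricP i.
by rewrite /simulated -Hd Hsim_eq0.
Qed.

Lemma same_Pre_game_bisimilar s t : obs_equiv s t ->
  (forall k, valuation k -> Pre P1 k s = Pre P1 k t) -> game_bisimilar s t.
Proof.
move=> st Pst; have [dd Hd _] := bisim_metricP P1.
rewrite /game_bisimilar -Hd /Hbisim !Hsim_eq0 ?maxxx //.
by move=> k vk; rewrite Pst.
Qed.

(** The fixpoint dominates the observation distance, which makes every observation a test
    function. *)
Lemma obs_Cset_sim_metric i v : Cset (@sim_metric R G i) (obs v).
Proof.
have [_ Hd _] := sim_metricP i; split=> [s|s t]; first exact: obs_itv.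
rewrite -Hd le_max; apply/orP; left.
exact: le_trans (ler_norm _) (obs_dist_ge v s t).
Qed.

Lemma obs_Cset_bisim_metric i v : Cset (@bisim_metric R G i) (obs v).
Proof.
have [_ Hd _] := bisim_metricP i; split=> [s|s t]; first exact: obs_itv.
rewrite -Hd !le_max; apply/orP; left; apply/orP; left.
exact: le_trans (ler_norm _) (obs_dist_ge v s t).
Qed.

(** Serves to refute simulation: at distance zero no test function, in particular no observation,
    has a larger one-step value in [s] than in [t]. *)
Lemma simulated_Pre_obs i v s t :
  simulated i s t -> Pre i (obs v) s <= Pre i (obs v) t.
Proof.
have [_ Hd _] := sim_metricP i; rewrite -subr_le0 /simulated => <-.
by rewrite -Hd; apply: Hsim_ge_Pre; exact: obs_Cset_sim_metric.
Qed.

Lemma game_bisimilar_Pre_obs v s t :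
  game_bisimilar s t -> Pre P1 (obs v) s <= Pre P1 (obs v) t.
Proof.
have [_ Hd _] := bisim_metricP P1; rewrite -subr_le0 /game_bisimilar => <-.
rewrite -Hd le_max; apply/orP; left.
by apply: Hsim_ge_Pre; exact: obs_Cset_bisim_metric.
Qed.

End Metrics.

(** * Couplings and the largest alternating relations *)

Section Relations.
Context {R : realType} {G : game R}.
Local Notation S := (state G).
Implicit Types (s t u v : S) (r : {set S * S}) (p q : distr R S).

Lemma lift_rel_mono r r' p q :
  r \subset r' -> lift_rel r p q -> lift_rel r' p q.
Proof.
move=> /fintype.subsetP rr' [D [D01 Dr Dp Dq]].
by exists D; split=> // u u' /Dr /rr'.
Qed.

(** The product coupling is concentrated on the single pair [(u, v)]. *)
Lemma lift_rel_point r p q u v : p =1 point u -> q =1 point v ->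
  (u, v) \in r -> lift_rel r p q.
Proof.
move=> pu qv uv; exists (fun w w' => point u w * point v w'); split.
- move=> w w'; apply/andP; split; first by rewrite mulr_ge0 ?dval_ge0.
  by rewrite mulr_ile1 ?dval_ge0 ?distr_le1.
- move=> w w' /=; case: eqP => [->|_]; last by rewrite mul0r ltxx.
  by case: eqP => [->//|_]; rewrite mulr0 ltxx.
- by move=> w; rewrite pu -mulr_sumr dval_sum1 mulr1.
- by move=> w; rewrite qv -mulr_suml dval_sum1 mul1r.
Qed.

(** A coupling with a point mass at [v] has no mass off the column of [v], so all the mass of [u]
    sits on [(u, v)]. *)
Lemma lift_rel_to_point r p q u v : q =1 point v -> 0 < p u ->
  lift_rel r p q -> (u, v) \in r.
Proof.
move=> qv pu [D [D01 Dr Dp Dq]]; apply: Dr.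
have D0 w w' : 0 <= D w w' by case/andP: (D01 w w').
have Dnv w : w != v -> D u w = 0.
  move=> wv; have := Dq w; rewrite qv /= (negbTE wv) => /esym/eqP.
  by rewrite psumr_eq0 // => /allP/(_ u); rewrite mem_index_enum => /(_ isT)/eqP.
by rewrite Dp (bigD1 v) //= big1 ?addr0 in pu.
Qed.

(** The union of all relations satisfying [P] is the largest one, as closure under unions keeps it
    within [P]. *)
Lemma largest_exists (P : {set S * S} -> Prop) :
  (forall A : pred {set S * S}, (forall r, A r -> P r) -> P (\bigcup_(r | A r) r)) ->
  is_largest P (largest P).
Proof.
move=> Pcup; apply: xgetPex; exists (\bigcup_(r | `[< P r >]) r); split.
  by apply: Pcup => r /asboolP.
by move=> r /asboolP Pr; exact: (finset.bigcup_sup r).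
Qed.

Lemma alt_sim_bigcup (A : pred {set S * S}) :
  (forall r, A r -> alt_sim r) -> alt_sim (\bigcup_(r | A r) r).
Proof.
move=> Asim s t /finset.bigcupP[r Ar rst]; have [st step] := Asim r Ar s t rst.
split=> // a1 /step[b1 tb1 {}step]; exists b1 => // b2 /step[a2 sa2 rab].
by exists a2 => //; apply: lift_rel_mono rab; exact: (finset.bigcup_sup r).
Qed.

Lemma alt_bisim_bigcup (A : pred {set S * S}) :
  (forall r, A r -> alt_bisim r) -> alt_bisim (\bigcup_(r | A r) r).
Proof.
move=> Abis; split; last by apply: alt_sim_bigcup => r /Abis[].
move=> s t /finset.bigcupP[r Ar rst]; apply/finset.bigcupP; exists r => //.
by case: (Abis r Ar) => rsym _; exact: rsym.
Qed.

Lemma alt_sim_simulated r s t : alt_sim r -> (s, t) \in r -> alt_simulated s t.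
Proof.
by move=> rsim; case: (largest_exists alt_sim_bigcup) => _ /(_ r rsim)/fintype.subsetP; apply.
Qed.

Lemma alt_bisim_bisimilar r s t : alt_bisim r -> (s, t) \in r -> alt_bisimilar s t.
Proof.
by move=> rbis; case: (largest_exists alt_bisim_bigcup) => _ /(_ r rbis)/fintype.subsetP; apply.
Qed.

Lemma alt_simulated_alt_sim s t :
  alt_simulated s t -> exists2 r, @alt_sim R G r & (s, t) \in r.
Proof.
by case: (largest_exists alt_sim_bigcup) => lsim _ st; exists (largest (@alt_sim R G)).
Qed.

Lemma alt_bisimilar_simulated s t : alt_bisimilar s t -> alt_simulated s t.
Proof.
by case: (largest_exists alt_bisim_bigcup) => -[_ lsim] _ /(alt_sim_simulated lsim).
Qed.

End Relations.

(** * Matching pennies: pure alternating relations miss the gain from randomizing *)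

Section Pennies.
Context (R : realType).

(* [(false, b)] is a sink carrying the result [b]; in [(true, true)] both
   players choose a side of the coin, while in [(true, false)] player 1 has to
   play [true]. *)
Definition pennies_obs (_ : unit) (s : bool * bool) : R := (s == (false, true))%:R.

Definition pennies_avail (i : player) (s : bool * bool) : {set bool} :=
  if (i, s.2) is (P1, false) then [set true] else [set: bool].

Definition pennies_next (s : bool * bool) (a1 a2 : bool) : bool * bool :=
  if s.1 then (false, a1 == a2) else s.

Lemma pennies_obs_itv v s : 0 <= pennies_obs v s <= 1.
Proof. by rewrite ler0n lern1 leq_b1. Qed.

Lemma true_in_pennies_avail i s : true \in pennies_avail i s.
Proof. by case: i; case: s => ? []; rewrite !inE. Qed.

Lemma pennies_avail_neq0 i s : exists a, a \in pennies_avail i s.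
Proof. by exists true; exact: true_in_pennies_avail. Qed.

Definition pennies : game R :=
  Game pennies_obs_itv pennies_avail_neq0
    (fun s a1 a2 => point (pennies_next s a1 a2)).

(** Identity pairs, together with all pairs of states in which the coin is still to be played. *)
Definition pennies_rel : {set state pennies * state pennies} :=
  [set p | (p.1 == p.2) || (p.1.1 && p.2.1)].

Lemma pennies_deterministic : deterministic pennies.
Proof. by move=> s a1 a2; exists (pennies_next s a1 a2). Qed.

Lemma pennies_alt_bisim : alt_bisim pennies_rel.
Proof.
split=> [s t|s t]; rewrite inE /=; first by rewrite inE /= eq_sym andbC.
move=> st; split.
  by case/orP: st => [/eqP-> //|]; case: s t => [[] ?] [[] ?].
move=> a1 sa1; exists true; first exact: true_in_pennies_avail.
(* This answer to [a1] makes the sides match in [s] exactly when [b2] matches the move [true] in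
   [t]. *)
move=> b2 _; exists (a1 == b2).
  by rewrite /= /pennies_avail inE.
apply: (@lift_rel_point R pennies _ _ _ (pennies_next s a1 (a1 == b2))
                                  (pennies_next t true b2)) => //.
have next_eq : (a1 == (a1 == b2)) = (true == b2) by case: a1 b2 {sa1} => [] [].
rewrite inE /pennies_next next_eq.
by case/orP: st => [/eqP->|/andP[-> ->]]; rewrite eqxx.
Qed.

Lemma pennies_expect s a1 a2 :
  pure_expect (G := pennies) (true, s) a1 a2 (pennies_obs tt) = (a1 == a2)%:R.
Proof.
rewrite /pure_expect /= (sum_pointM (P := xpredT)) // /pennies_obs.
by case: a1 a2 => [] [].
Qed.

Lemma coin_ge0 (b : bool) : 0 <= 2^-1 :> R. Proof. lra. Qed.

Lemma coin_sum1 : \sum_(b : bool) 2^-1 = 1 :> R.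
Proof. rewrite big_bool /=; lra. Qed.

(** Whatever side player 2 picks, a fair coin matches it with probability one half. *)
Lemma Pre_pennies_ge : 2^-1 <= Pre (G := pennies) P1 (pennies_obs tt) (true, true).
Proof.
apply: (@Pre1_ge_mixed R pennies _ (Distr coin_ge0 coin_sum1)).
- exact: pennies_obs_itv.
- by move=> a; rewrite inE.
move=> a2 _.
rewrite (eq_bigl xpredT) => [|a]; last by rewrite inE.
by rewrite big_bool /= !pennies_expect; case: a2; rewrite /=; lra.
Qed.

(** Player 1 is bound to [true], so the answer [false] never matches. *)
Lemma Pre_pennies_le : Pre (G := pennies) P1 (pennies_obs tt) (true, false) <= 0.
Proof.
apply: (@Pre1_le_pure R pennies _ false).
- exact: pennies_obs_itv.
- by rewrite inE.
by move=> a1; rewrite inE => /eqP->; rewrite pennies_expect.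
Qed.

Lemma Pre_pennies_nle :
  ~ Pre (G := pennies) P1 (pennies_obs tt) (true, true)
    <= Pre (G := pennies) P1 (pennies_obs tt) (true, false).
Proof. have := Pre_pennies_ge; have := Pre_pennies_le; lra. Qed.

End Pennies.

(** * The lottery: a mixed move simulates what no pure move can *)

Section Lottery.
Context (R : realType).

(* [(false, b)] is a sink, and [Some b] leads to it from [(true, _)]; [None] is
   the fair lottery, available to player 1 in [(true, true)] but not in
   [(true, false)], and also the dummy move where there is no choice. *)
Definition lottery_obs (_ : unit) (s : bool * bool) : R := (s != (false, false))%:R.

Definition lottery_avail (i : player) (s : bool * bool) : {set option bool} :=
  match i, s with
  | P1, (true, true) => [set: option bool]
  | P1, (true, false) => [set~ None]
  | _, _ => [set None]
  end.

Definition fair_sink (s : bool * bool) : R := if s.1 then 0 else 2^-1.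

Lemma fair_sink_ge0 s : 0 <= fair_sink s.
Proof. by rewrite /fair_sink; case: s.1 => //; lra. Qed.

Lemma sum_fair_sink k : \sum_s fair_sink s * k s =
  2^-1 * k (false, true) + 2^-1 * k (false, false).
Proof.
rewrite (eq_bigr (fun s => fair_sink (s.1, s.2) * k (s.1, s.2))) => [|[]//].
by rewrite -(pair_bigA _ (fun a b => fair_sink (a, b) * k (a, b))) /=
           !big_bool /= /fair_sink /= !mul0r !add0r.
Qed.

Lemma fair_sink_sum1 : \sum_s fair_sink s = 1.
Proof.
under eq_bigr do rewrite -[fair_sink _]mulr1.
by rewrite (sum_fair_sink (fun=> 1)); lra.
Qed.

Definition lottery_delta (s : bool * bool) (a1 _ : option bool) :
    distr R (bool * bool)%type :=
  if s.1 then
    if a1 is Some b then point (false, b) else Distr fair_sink_ge0 fair_sink_sum1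
  else point s.

Lemma lottery_obs_itv v s : 0 <= lottery_obs v s <= 1.
Proof. by rewrite ler0n lern1 leq_b1. Qed.

Lemma lottery_avail_neq0 i s : exists a, a \in lottery_avail i s.
Proof.
case: i s => [] [[] []]; try by exists None; rewrite inE.
by exists (Some true); rewrite !inE.
Qed.

Definition lottery : game R :=
  Game lottery_obs_itv lottery_avail_neq0 lottery_delta.

Lemma lottery_turn_based : turn_based lottery.
Proof.
(* Only the sink [(false, false)] is given to player 2, so that the one observation, which tells the
   sinks apart, also serves as the turn variable. *)
exists [set s | s != (false, false)]; split.
- by move=> s _; rewrite cards1.
- by move=> s; rewrite inE negbK => /eqP->; rewrite cards1.
exists tt => s; rewrite /= /lottery_obs !inE negbK.
by case: (s == _) => /=; split; split=> // /eqP; rewrite ?oner_eq0 // eq_sym oner_eq0.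
Qed.

(** The dummy move of player 2 gives the upper bound, the lottery contributing only the mean of the
    two sinks; the two sure moves, available for either [b], give the lower bound. *)
Lemma Pre_lottery k b : valuation (G := lottery) k ->
  Pre (G := lottery) P1 k (true, b) =
  Num.max (k (false, true)) (k (false, false)).
Proof.
move=> vk; apply/eqP; rewrite eq_le; apply/andP; split.
  apply: (@Pre1_le_pure R lottery _ None _ _ vk); first by rewrite inE.
  move=> [b'|] _; rewrite /pure_expect /=.
    rewrite (sum_pointM (P := xpredT)) // le_max.
    by case: b'; rewrite lexx ?orbT.
  rewrite sum_fair_sink.
  by case: (leP (k (false, true)) (k (false, false))); lra.
rewrite ge_max; apply/andP; split.
  apply: (@Pre1_ge_pure R lottery _ (Some true) _ _ vk); first by case: b; rewrite !inE.
  by move=> a2 _; rewrite /pure_expect /= (sum_pointM (P := xpredT)).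
apply: (@Pre1_ge_pure R lottery _ (Some false) _ _ vk); first by case: b; rewrite !inE.
by move=> a2 _; rewrite /pure_expect /= (sum_pointM (P := xpredT)).
Qed.

(** A reply [Some b] to the lottery leads surely to one sink, while the lottery also reaches the
    other, [(false, ~~ b)]; the lifting then relates two sinks with different observations. *)
Lemma lottery_not_alt_simulated :
  ~ alt_simulated (G := lottery) (true, true) (true, false).
Proof.
case/alt_simulated_alt_sim => r rsim rst; have [_ step] := rsim _ _ rst.
have [|b1 tb1 {}step] := step None; first by rewrite inE.
have [|a2 _ rab] := step None; first by rewrite inE.
case: b1 tb1 rab {step} => [b|] tb1 rab; last by rewrite !inE in tb1.
have /rsim[/(_ tt)] : ((false, ~~ b), (false, b)) \in r.
  by apply: lift_rel_to_point rab => //=; rewrite /fair_sink /=; lra.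
by rewrite /= /lottery_obs; case: b {tb1 rab} => /= /eqP;
  rewrite ?oner_eq0 // eq_sym oner_eq0.
Qed.

End Lottery.

Theorem theorem4p4 (R : realType) :
  (exists (G : game R) (s t : state G),
     deterministic G /\
     (alt_simulated s t /\ ~ simulated P1 s t) /\
     (alt_bisimilar s t /\ ~ game_bisimilar s t)) /\
  (exists (G : game R) (s t : state G),
     turn_based G /\
     (simulated P1 s t /\ ~ alt_simulated s t) /\
     (game_bisimilar s t /\ ~ alt_bisimilar s t)).
Proof.
split.
  exists (pennies R), (true, true), (true, false).
  have st : alt_bisimilar (G := pennies R) (true, true) (true, false).
    by apply: alt_bisim_bisimilar (pennies_alt_bisim R) _; rewrite inE.
  split; first exact: pennies_deterministic.
  split; split=> //.
  - exact: alt_bisimilar_simulated.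
  (* The result of the play, as test function, has value at least one half in the first state and at
     most 0 in the second. *)
  - by move/simulated_Pre_obs => /(_ tt); exact: Pre_pennies_nle.
  - by move/game_bisimilar_Pre_obs => /(_ tt); exact: Pre_pennies_nle.
exists (lottery R), (true, true), (true, false).
have same k : valuation (G := lottery R) k ->
    Pre (G := lottery R) P1 k (true, true) = Pre (G := lottery R) P1 k (true, false).
  by move=> vk; rewrite !Pre_lottery.
split; first exact: lottery_turn_based.
split; split.
- exact: same_Pre_simulated.
- exact: lottery_not_alt_simulated.
- exact: same_Pre_game_bisimilar.
- by move/alt_bisimilar_simulated; exact: lottery_not_alt_simulated.
Qed.
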